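(* Let $(\mathcal{A},\varphi,\mathcal{X},f,\Phi)$ be a non-commutative probability space of type B, let $\{(\mathcal{A}_k,\mathcal{X}_k)\}_{k\ge1}$ be type B free independent in it, and let $(a_k,\xi_k)\in\mathcal{A}_k\times\mathcal{X}_k$, $k\ge1$, be identically distributed with $\varphi(a_k)=f(\xi_k)=0$ and $E\big((a_k,\xi_k)^2\big)=(1,1)$, i.e. $\varphi(a_k^2)=1$ and $f(a_k\xi_k+\xi_ka_k)=1$. Then the limit distribution moments of $$S_N=\frac{(a_1,\xi_1)+\dots+(a_N,\xi_N)}{\sqrt N}$$ are $\{(m_n,\mathfrak{m}_n)\}_{n\ge1}$, i.e. $\lim_{N\to\infty}E(S_N^n)=(m_n,\mathfrak{m}_n)$ for every $n\ge1$, where $m_n$ is the $n$-th moment of the (centered, variance $1$) semicircular distribution and $$\mathfrak{m}_n=\begin{cases}0&\text{if } n \text{ is odd},\\[2pt] \binom{2k}{k+1}&\text{if } n=2k \text{ is even}.\end{cases}$$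
   Context: A non-commutative probability space of type B is a system $(\mathcal{A},\varphi,\mathcal{X},f,\Phi)$ where $\mathcal{A}$ is a complex unital algebra, $\varphi:\mathcal{A}\to\mathbb{C}$ is linear with $\varphi(1)=1$, $\mathcal{X}$ is a complex vector space, $f:\mathcal{X}\to\mathbb{C}$ is linear, and $\Phi:\mathcal{A}\times\mathcal{X}\times\mathcal{A}\to\mathcal{X}$ is a two-sided action of $\mathcal{A}$ on $\mathcal{X}$ (an $\mathcal{A}$-bimodule structure), written $a\xi b=\Phi(a,\xi,b)$. The vector space $\mathcal{A}\times\mathcal{X}$ is a unital algebra with multiplication $(a,\xi)\cdot(b,\eta)=(ab,a\eta+\xi b)$. $\mathcal{C}$ is the commutative unital algebra $\mathbb{C}\times\mathbb{C}$ (with componentwise vector space structure) with multiplication $(x,t)\cdot(y,s)=(xy,xs+ty)$ and unit $(1,0)$. Define $E:\mathcal{A}\times\mathcal{X}\to\mathcal{C}$ by $E(a,\xi)=(\varphi(a),f(\xi))$. The moments of $(a,\xi)$ are $E((a,\xi)^n)$, $n\ge1$; elements are identically distributed if they have the same moments. Limits in $\mathcal{C}$ are componentwise. The type B non-crossing cumulants are the multilinear maps $\kappa_n:(\mathcal{A}\times\mathcal{X})^n\to\mathcal{C}$, $n\ge1$, determined by $$\sum_{\gamma\in NC(n)}\ \prod_{B\in\gamma}\kappa_{|B|}\big((a_1,\xi_1),\dots,(a_n,\xi_n)\,|\,B\big)=E\big((a_1,\xi_1)\cdots(a_n,\xi_n)\big)$$ for all $n\geq 1$, $a_i\in\mathcal{A}$,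 $\xi_i\in\mathcal{X}$, where $NC(n)$ is the lattice of (ordinary, type A) non-crossing partitions of $\{1,\dots,n\}$, the notation $|\,B$ means keeping only the arguments with index in the block $B$, in increasing order, and the product on the left is in $\mathcal{C}$. Free independence: let $\{\mathcal{A}_k\}$ be unital subalgebras of $\mathcal{A}$ and $\{\mathcal{X}_k\}$ linear subspaces of $\mathcal{X}$ with $\mathcal{X}_k$ invariant under the action of $\mathcal{A}_k$. The pairs $(\mathcal{A}_k,\mathcal{X}_k)$ are (type B) free independent if $\kappa_n((a_1,\xi_1),\dots,(a_n,\xi_n))=0$ whenever $a_l\in\mathcal{A}_{i_l}$, $\xi_l\in\mathcal{X}_{i_l}$ ($l=1,\dots,n$) and there exist $1\le s<t\le n$ with $i_s\ne i_t$. *)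

(* Defs.v *)
(* The complex field is R[i], for R a model of the reals. *)
From HB Require Import structures.
From mathcomp Require Import all_boot all_order all_algebra.
From mathcomp Require Import all_classical all_reals all_analysis.
From mathcomp Require Import complex.

Set Implicit Arguments.
Unset Strict Implicit.
Unset Printing Implicit Defensive.

Import Order.TTheory GRing.Theory Num.Theory.
Import numFieldNormedType.Exports.

Local Open Scope ring_scope.
Local Open Scope complex_scope.

(* An algType is nontrivial (1 != 0), which is no restriction here since
   phi 1 = 1. *)
Record ncps_typeB (R : realType) := NcpsTypeB {
  tbA : algType R[i];
  tbphi : {scalar tbA};
  tbphi1 : tbphi 1 = 1;
  tbX : lmodType R[i];
  tbf : {scalar tbX};
  tbact : tbA -> tbX -> tbA -> tbX;
  tbact_linearl : forall xi b, linear (fun a => tbact a xi b);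
  tbact_linear : forall a b, linear (fun xi => tbact a xi b);
  tbact_linearr : forall a xi, linear (fun b => tbact a xi b);
  tbact1 : forall xi, tbact 1 xi 1 = xi;
  tbactA : forall a b xi c d,
    tbact a (tbact b xi c) d = tbact (a * b) xi (c * d) }.

Section Action.
Context {R : realType} (S : ncps_typeB R).
Implicit Types (a b c : tbA S) (xi eta : tbX S).

Lemma tbactDl a b xi c : tbact (a + b) xi c = tbact a xi c + tbact b xi c.
Proof. by have := tbact_linearl xi c 1 a b; rewrite !scale1r. Qed.

Lemma tbactDm a xi eta c : tbact a (xi + eta) c = tbact a xi c + tbact a eta c.
Proof. by have := tbact_linear a c 1 xi eta; rewrite !scale1r. Qed.

Lemma tbactDr a xi b c : tbact a xi (b + c) = tbact a xi b + tbact a xi c.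
Proof. by have := tbact_linearr a xi 1 b c; rewrite !scale1r. Qed.

Lemma tbact0m a c : tbact a (0 : tbX S) c = 0.
Proof. by apply: (addrI (tbact a 0 c)); rewrite -tbactDm !addr0. Qed.

Lemma tbact0l xi c : tbact 0 xi c = 0.
Proof. by apply: (addrI (tbact 0 xi c)); rewrite -tbactDl !addr0. Qed.

Lemma tbact0r a xi : tbact a xi 0 = 0.
Proof. by apply: (addrI (tbact a xi 0)); rewrite -tbactDr !addr0. Qed.

Lemma tbactZl (z : R[i]) a xi c : tbact (z *: a) xi c = z *: tbact a xi c.
Proof. by have := tbact_linearl xi c z a 0; rewrite !addr0 tbact0l addr0. Qed.

Lemma tbactZm (z : R[i]) a xi c : tbact a (z *: xi) c = z *: tbact a xi c.
Proof. by have := tbact_linear a c z xi 0; rewrite !addr0 tbact0m addr0. Qed.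

Lemma tbactZr (z : R[i]) a xi c : tbact a xi (z *: c) = z *: tbact a xi c.
Proof. by have := tbact_linearr a xi z c 0; rewrite !addr0 tbact0r addr0. Qed.

End Action.

(* A * X and C are records rather than synonyms of product types, which carry
   the componentwise multiplication in MathComp. *)
Record tbAX (R : realType) (S : ncps_typeB R) := TbAX {
  tbfst : tbA S;
  tbsnd : tbX S }.
Arguments TbAX {R S}.

Section AXalgebra.
Context {R : realType} (S : ncps_typeB R).
Implicit Types (p q r : tbAX S).

Definition tbAX_pair (p : tbAX S) := (tbfst p, tbsnd p).

Lemma tbAX_pairK :
  cancel tbAX_pair (fun u => TbAX u.1 u.2).
Proof. by case. Qed.

HB.instance Definition _ := Choice.copy (tbAX S) (can_type tbAX_pairK).

Lemma tbAX_eqP p q : tbfst p = tbfst q -> tbsnd p = tbsnd q -> p = q.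
Proof. by case: p q => [? ?] [? ?] /= -> ->. Qed.

Definition tbAX_zero : tbAX S := TbAX 0 0.
Definition tbAX_opp p : tbAX S := TbAX (- tbfst p) (- tbsnd p).
Definition tbAX_add p q : tbAX S :=
  TbAX (tbfst p + tbfst q) (tbsnd p + tbsnd q).

Lemma tbAX_addA : associative tbAX_add.
Proof. by move=> p q r; apply: tbAX_eqP; rewrite /= addrA. Qed.

Lemma tbAX_addC : commutative tbAX_add.
Proof. by move=> p q; apply: tbAX_eqP; rewrite /= addrC. Qed.

Lemma tbAX_add0 : left_id tbAX_zero tbAX_add.
Proof. by move=> p; apply: tbAX_eqP; rewrite /= add0r. Qed.

Lemma tbAX_addN : left_inverse tbAX_zero tbAX_opp tbAX_add.
Proof. by move=> p; apply: tbAX_eqP; rewrite /= addNr. Qed.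

HB.instance Definition _ := GRing.isZmodule.Build (tbAX S)
  tbAX_addA tbAX_addC tbAX_add0 tbAX_addN.

Definition tbAX_scale (z : R[i]) p : tbAX S :=
  TbAX (z *: tbfst p) (z *: tbsnd p).

Lemma tbAX_scalerA (z w : R[i]) p :
  tbAX_scale z (tbAX_scale w p) = tbAX_scale (z * w) p.
Proof. by apply: tbAX_eqP; rewrite /= scalerA. Qed.

Lemma tbAX_scale1 : left_id 1 tbAX_scale.
Proof. by move=> p; apply: tbAX_eqP; rewrite /= scale1r. Qed.

Lemma tbAX_scalerDr : right_distributive tbAX_scale +%R.
Proof. by move=> z p q; apply: tbAX_eqP; rewrite /= scalerDr. Qed.

Lemma tbAX_scalerDl p : {morph tbAX_scale^~ p : z w / z + w}.
Proof. by move=> z w; apply: tbAX_eqP; rewrite /= scalerDl. Qed.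

HB.instance Definition _ := GRing.Zmodule_isLmodule.Build R[i] (tbAX S)
  tbAX_scalerA tbAX_scale1 tbAX_scalerDr tbAX_scalerDl.

Definition tbAX_one : tbAX S := TbAX 1 0.

Definition tbAX_mul p q : tbAX S :=
  TbAX (tbfst p * tbfst q)
       (tbact (tbfst p) (tbsnd q) 1 + tbact 1 (tbsnd p) (tbfst q)).

Lemma tbAX_mulA : associative tbAX_mul.
Proof.
move=> p q r; apply: tbAX_eqP; rewrite /= ?mulrA//.
by rewrite !tbactDm !tbactA !mulr1 !mul1r addrA.
Qed.

Lemma tbAX_mul1 : left_id tbAX_one tbAX_mul.
Proof.
by move=> p; apply: tbAX_eqP; rewrite /= ?mul1r// tbact0m addr0 tbact1.
Qed.

Lemma tbAX_mulr1 : right_id tbAX_one tbAX_mul.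
Proof.
by move=> p; apply: tbAX_eqP; rewrite /= ?mulr1// tbact0m add0r tbact1.
Qed.

Lemma tbAX_mulDl : left_distributive tbAX_mul +%R.
Proof.
move=> p q r; apply: tbAX_eqP; rewrite /= ?mulrDl//.
by rewrite tbactDl tbactDm addrACA.
Qed.

Lemma tbAX_mulDr : right_distributive tbAX_mul +%R.
Proof.
move=> p q r; apply: tbAX_eqP; rewrite /= ?mulrDr//.
by rewrite tbactDm tbactDr addrACA.
Qed.

Lemma tbAX_oner_neq0 : tbAX_one != 0.
Proof. by apply/eqP => /(congr1 (@tbfst R S))/eqP; rewrite oner_eq0. Qed.

HB.instance Definition _ := GRing.Zmodule_isNzRing.Build (tbAX S)
  tbAX_mulA tbAX_mul1 tbAX_mulr1 tbAX_mulDl tbAX_mulDr tbAX_oner_neq0.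

Lemma tbAX_scalerAl (z : R[i]) p q : z *: (p * q) = z *: p * q.
Proof.
apply: tbAX_eqP; rewrite /= ?scalerAl//.
by rewrite scalerDr tbactZl tbactZm.
Qed.

HB.instance Definition _ :=
  GRing.Lmodule_isLalgebra.Build R[i] (tbAX S) tbAX_scalerAl.

Lemma tbAX_scalerAr (z : R[i]) p q : z *: (p * q) = p * (z *: q).
Proof.
apply: tbAX_eqP; rewrite /= ?scalerAr//.
by rewrite scalerDr tbactZm tbactZr.
Qed.

HB.instance Definition _ :=
  GRing.Lalgebra_isAlgebra.Build R[i] (tbAX S) tbAX_scalerAr.

End AXalgebra.

Record tbC (R : realType) := TbC { tbC1 : R[i]; tbC2 : R[i] }.

Section Calgebra.
Context {R : realType}.
Implicit Types p q r : tbC R.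

Definition tbC_pair (p : tbC R) := (tbC1 p, tbC2 p).

Lemma tbC_pairK :
  cancel tbC_pair (fun u => TbC u.1 u.2).
Proof. by case. Qed.

HB.instance Definition _ := Choice.copy (tbC R) (can_type tbC_pairK).

Lemma tbC_eqP p q : tbC1 p = tbC1 q -> tbC2 p = tbC2 q -> p = q.
Proof. by case: p q => [? ?] [? ?] /= -> ->. Qed.

Definition tbC_zero : tbC R := TbC 0 0.
Definition tbC_opp p : tbC R := TbC (- tbC1 p) (- tbC2 p).
Definition tbC_add p q : tbC R :=
  TbC (tbC1 p + tbC1 q) (tbC2 p + tbC2 q).

Lemma tbC_addA : associative tbC_add.
Proof. by move=> p q r; apply: tbC_eqP; rewrite /= addrA. Qed.

Lemma tbC_addC : commutative tbC_add.
Proof. by move=> p q; apply: tbC_eqP; rewrite /= addrC. Qed.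

Lemma tbC_add0 : left_id tbC_zero tbC_add.
Proof. by move=> p; apply: tbC_eqP; rewrite /= add0r. Qed.

Lemma tbC_addN : left_inverse tbC_zero tbC_opp tbC_add.
Proof. by move=> p; apply: tbC_eqP; rewrite /= addNr. Qed.

HB.instance Definition _ := GRing.isZmodule.Build (tbC R)
  tbC_addA tbC_addC tbC_add0 tbC_addN.

Definition tbC_scale (z : R[i]) p : tbC R :=
  TbC (z * tbC1 p) (z * tbC2 p).

Lemma tbC_scalerA (z w : R[i]) p :
  tbC_scale z (tbC_scale w p) = tbC_scale (z * w) p.
Proof. by apply: tbC_eqP; rewrite /= mulrA. Qed.

Lemma tbC_scale1 : left_id 1 tbC_scale.
Proof. by move=> p; apply: tbC_eqP; rewrite /= mul1r. Qed.

Lemma tbC_scalerDr : right_distributive tbC_scale +%R.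
Proof. by move=> z p q; apply: tbC_eqP; rewrite /= mulrDr. Qed.

Lemma tbC_scalerDl p : {morph tbC_scale^~ p : z w / z + w}.
Proof. by move=> z w; apply: tbC_eqP; rewrite /= mulrDl. Qed.

HB.instance Definition _ := GRing.Zmodule_isLmodule.Build R[i] (tbC R)
  tbC_scalerA tbC_scale1 tbC_scalerDr tbC_scalerDl.

Definition tbC_one : tbC R := TbC 1 0.

Definition tbC_mul p q : tbC R :=
  TbC (tbC1 p * tbC1 q) (tbC1 p * tbC2 q + tbC2 p * tbC1 q).

Lemma tbC_mulA : associative tbC_mul.
Proof.
move=> p q r; apply: tbC_eqP; rewrite /= ?mulrA//.
by rewrite mulrDr mulrDl !mulrA addrA.
Qed.

Lemma tbC_mulC : commutative tbC_mul.
Proof.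
move=> p q; apply: tbC_eqP => /=; first exact: mulrC.
by rewrite addrC [tbC2 p * _]mulrC [tbC1 p * _]mulrC.
Qed.

Lemma tbC_mul1 : left_id tbC_one tbC_mul.
Proof. by move=> p; apply: tbC_eqP; rewrite /= !mul1r// mul0r addr0. Qed.

Lemma tbC_mulDl : left_distributive tbC_mul +%R.
Proof.
move=> p q r; apply: tbC_eqP; rewrite /= ?mulrDl//.
by rewrite addrACA.
Qed.

Lemma tbC_oner_neq0 : tbC_one != 0.
Proof. by apply/eqP => /(congr1 (@tbC1 R))/eqP; rewrite oner_eq0. Qed.

HB.instance Definition _ := GRing.Zmodule_isComNzRing.Build (tbC R)
  tbC_mulA tbC_mulC tbC_mul1 tbC_mulDl tbC_oner_neq0.

Lemma tbC_scalerAl (z : R[i]) p q : z *: (p * q) = z *: p * q.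
Proof. by apply: tbC_eqP; rewrite /= ?mulrDr !mulrA. Qed.

HB.instance Definition _ :=
  GRing.Lmodule_isLalgebra.Build R[i] (tbC R) tbC_scalerAl.

Lemma tbC_scalerAr (z : R[i]) p q : z *: (p * q) = p * (z *: q).
Proof. by rewrite mulrC tbC_scalerAl mulrC. Qed.

HB.instance Definition _ :=
  GRing.Lalgebra_isAlgebra.Build R[i] (tbC R) tbC_scalerAr.

End Calgebra.

Definition tbE (R : realType) (S : ncps_typeB R) (p : tbAX S) : tbC R :=
  TbC (tbphi S (tbfst p)) (tbf S (tbsnd p)).

Definition noncrossing (n : nat) (g : {set {set 'I_n}}) : bool :=
  [forall B in g, forall B' in g,
     forall i in B, forall j in B', forall k in B, forall l in B',
       [&& (i < j)%N, (j < k)%N & (k < l)%N] ==> (B == B')].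

Definition NC (n : nat) : {set {set {set 'I_n}}} :=
  [set g | finset.partition g [set: 'I_n]%SET && noncrossing g]%SET.

(* A family of maps kappa_n : (A * X)^n -> C, n >= 1, is encoded as one map on
   sequences, kappa_n being its restriction to sequences of size n; the value
   at [::] is never used. *)
Definition multilinear_family (R : realType) (S : ncps_typeB R)
    (kappa : seq (tbAX S) -> tbC R) : Prop :=
  forall (s1 s2 : seq (tbAX S)),
    linear (fun p : tbAX S => kappa (s1 ++ p :: s2)).

(* enum B lists the elements of the block B in increasing order. *)
Definition is_typeB_cumulants (R : realType) (S : ncps_typeB R)
    (kappa : seq (tbAX S) -> tbC R) : Prop :=
  multilinear_family kappa /\
  forall (n : nat) (s : n.-tuple (tbAX S)), (0 < n)%N ->
    \sum_(g in NC n) \prod_(B in g) kappa [seq tnth s i | i <- enum B] =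
    tbE (\prod_(p <- s) p).

Definition typeB_free (R : realType) (S : ncps_typeB R)
    (kappa : seq (tbAX S) -> tbC R)
    (Ak : nat -> {pred tbA S}) (Xk : nat -> {pred tbX S}) : Prop :=
  forall (n : nat) (s : n.-tuple (tbAX S)) (c : 'I_n -> nat),
    (forall l, tbfst (tnth s l) \in Ak (c l) /\
               tbsnd (tnth s l) \in Xk (c l)) ->
    (exists i j : 'I_n, (i < j)%N /\ c i <> c j) ->
    kappa s = 0.

Definition identically_distributed (R : realType) (S : ncps_typeB R)
    (p q : tbAX S) : Prop :=
  forall n : nat, (0 < n)%N -> tbE (p ^+ n) = tbE (q ^+ n).

Local Open Scope classical_set_scope.

(* R[i]^o is the carrier of the usual topology of the complex plane. *)
Definition tbC_cvg (R : realType) (u : nat -> tbC R) (l : tbC R) : Prop :=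
  (fun N => tbC1 (u N)) @ \oo --> (tbC1 l : R[i]^o) /\
  (fun N => tbC2 (u N)) @ \oo --> (tbC2 l : R[i]^o).

(* Density on [-2, 2] of the semicircular law of mean 0 and variance 1. *)
Definition semicircle_density (R : realType) (x : R) : R :=
  Num.sqrt (4 - x ^+ 2) / (2 * pi).

Definition semicircle_moment (R : realType) (n : nat) : R :=
  \int[lebesgue_measure]_(x in `[(-2 : R), 2])
    (x ^+ n * semicircle_density x).

Definition infinitesimal_moment (R : realType) (n : nat) : R :=
  if odd n then 0 else 'C(n, n./2.+1)%:R.

(* Main.v *)
Require Import Defs.
From HB Require Import structures.
From mathcomp Require Import all_boot all_order all_algebra.
From mathcomp Require Import all_classical all_reals all_analysis.
From mathcomp Require Import complex.
From mathcomp Require Import ring lra zify.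
Import Order.TTheory GRing.Theory Num.Theory.
Import numFieldNormedType.Exports.
Local Open Scope ring_scope.
Local Open Scope complex_scope.

(** Put [x_k = (a_k, xi_k)] and [S_N = N^(-1/2) (x_0 + ... + x_(N-1))].  Since [C]
is a commutative algebra, the type B moment-cumulant formula has the same shape as
the scalar one, and the classical proof of the free central limit theorem can
be carried out with values in [C].  Freeness kills the mixed cumulants
([cumulant_sum]), and identically distributed elements have the same cumulants
([cumulant_moments]), so the cumulant of order [j] of [S_N] is
[N^(1 - j/2) k_j], where [k_j] is the one of [x_0].  Hence, by
[moment_scaled_sum], [E (S_N^n)] is the sum over [g] in [NC n] of
[N^(#|g| - n/2)] times the product of the [k_#|B|] for [B] in [g].

Here [k_1 = 0] and [k_2 = (1, 1)].  A partition with a singleton contributes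
nothing; if all its blocks have at least two points and one has more, then
[#|g| < n/2] and its term tends to 0.  Only the pairings are left, each
contributing [(1, 1)^(n/2) = (1, n/2)] ([cvg_NC_term]); so the limit is
[(c, c * n/2)] with [c] the number of non-crossing pairings of [n] points.

It remains to identify [c].  It is 0 for odd [n].  For [n = 2k] a ballot
recursion gives [c = 'C(2k, k) - 'C(2k, k+1)] ([card_NC2]), the Catalan number,
and then [c * k = 'C(2k, k+1)].  On the analytic side, integrating the
derivative of [x^(n+1) (4 - x^2)^(3/2)] over [[-2, 2]] gives the two-step
recursion of the Catalan numbers for the semicircular moments
([raw_moment_rec]). *)

Set Implicit Arguments.
Unset Strict Implicit.
Unset Printing Implicit Defensive.

(** * Moments of the semicircular law *)

Section SemicircleMoments.
Local Open Scope classical_set_scope.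

Definition semicircle {R : realType} (x : R) : R := Num.sqrt (4 - x ^+ 2).

Lemma continuous_semicircle {R : realType} : continuous (@semicircle R).
Proof.
move=> x; rewrite /semicircle.
apply: (@continuous_comp _ _ _ (fun x : R => 4 - x ^+ 2) Num.sqrt).
  by apply: continuousB; [exact: cvg_cst|exact: exprn_continuous].
exact: sqrt_continuous.
Qed.

Lemma continuous_semicircle3 {R : realType} :
  continuous (fun x : R => semicircle x ^+ 3).
Proof.
move=> x; apply: (@continuous_comp _ _ _ semicircle (fun y : R => y ^+ 3)).
  exact: continuous_semicircle.
exact: exprn_continuous.
Qed.

Lemma semicircle_arg_gt0 {R : realType} (x : R) :
  x \in `](-2 : R), 2[%R -> 0 < 4 - x ^+ 2.
Proof.
rewrite in_itv/= => /andP[x1 x2].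
have -> : 4 - x ^+ 2 = (2 - x) * (2 + x) by ring.
by apply: mulr_gt0; lra.
Qed.

Lemma sqr_semicircle {R : realType} (x : R) : x \in `](-2 : R), 2[%R ->
  semicircle x ^+ 2 = 4 - x ^+ 2.
Proof. by move=> /semicircle_arg_gt0/ltW ?; rewrite sqr_sqrtr. Qed.

Lemma semicircle_gt0 {R : realType} (x : R) :
  x \in `](-2 : R), 2[%R -> 0 < semicircle x.
Proof. by move=> /semicircle_arg_gt0; rewrite sqrtr_gt0. Qed.

Lemma is_derive_semicircle {R : realType} (x : R) : x \in `](-2 : R), 2[%R ->
  is_derive x 1 (@semicircle R) (- x / semicircle x).
Proof.
move=> xI; have x0 := semicircle_arg_gt0 xI.
have s0 := semicircle_gt0 xI.
have d1 : is_derive x 1 (fun x : R => 4 - x ^+ 2) (- (2 * x)).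
  by apply: is_derive_eq; rewrite /GRing.scale/=; ring.
have d2 := is_derive1_sqrt x0.
have := @is_derive1_comp _ Num.sqrt (fun x : R => 4 - x ^+ 2) _ _ _ d2 d1.
move=> d3; apply: (is_derive_eq d3).
rewrite -/(semicircle x); field; exact: lt0r_neq0.
Qed.

(** Differentiability is asked in the interior only: at the ends of the interval
[semicircle] and [x |-> asin (x / 2)] have vertical tangents. *)
Lemma Rintegral_FTC {R : realType} (f F : R -> R) :
  continuous f -> (forall x, x \in `](-2 : R), 2[%R -> is_derive x 1 F (f x)) ->
  {within `[-2, 2], continuous F} ->
  \int[lebesgue_measure]_(x in `[(-2 : R), 2]) f x = F 2 - F (-2).
Proof.
move=> cf dF cF; have lt22 : (-2 : R) < 2 by lra.
have [_ Fl Fr] := (continuous_within_itvP _ lt22).1 cF.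
rewrite /Rintegral (@continuous_FTC2 _ f F)//.
- exact: continuous_subspaceT.
- by split => // x xI; have := dF _ xI => -[].
- move=> x xI; rewrite derive1E; by have [] := dF _ xI.
Qed.

(** The moments of the density [semicircle], whose total mass is [2 * pi]. *)
Definition raw_moment (R : realType) (n : nat) : R :=
  \int[lebesgue_measure]_(x in `[(-2 : R), 2]) (x ^+ n * semicircle x).

Lemma continuous_raw {R : realType} n :
  continuous (fun x : R => x ^+ n * semicircle x).
Proof.
move=> x; apply: (@continuousM R R (fun x => x ^+ n) semicircle).
  exact: exprn_continuous.
exact: continuous_semicircle.
Qed.

Lemma continuous_integrable {R : realType} (f : R -> R) : continuous f ->
  (@lebesgue_measure R).-integrable `[(-2 : R), 2] (EFin \o f).
Proof.
move=> cf; apply: continuous_compact_integrable; first exact: segment_compact.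
exact: continuous_subspaceT.
Qed.

Lemma semicircle_momentE {R : realType} n :
  semicircle_moment R n = (2 * pi)^-1 * raw_moment R n.
Proof.
rewrite /semicircle_moment /semicircle_density -RintegralZl//.
  by apply: eq_Rintegral => x _; rewrite -/(semicircle x); ring.
apply: (@continuous_integrable R (fun x => x ^+ n * semicircle x)).
exact: continuous_raw.
Qed.

(** [x * semicircle x] is the derivative of [- (4 - x^2)^(3/2) / 3], which
vanishes at both ends. *)
Lemma raw_moment1 {R : realType} : raw_moment R 1 = 0.
Proof.
pose F (x : R) := - 3^-1 * semicircle x ^+ 3.
apply: (etrans (@Rintegral_FTC R _ F _ _ _)).
- exact: continuous_raw.
- move=> x xI; have ds := is_derive_semicircle xI.
  have s0 := lt0r_neq0 (semicircle_gt0 xI).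
  rewrite /F; apply: is_derive_eq; rewrite /GRing.scale/=.
  by field.
- apply: continuous_subspaceT => x; apply: cvgM; first exact: cvg_cst.
  exact: continuous_semicircle3.
- rewrite /F /semicircle; have -> : (-2 : R) ^+ 2 = 2 ^+ 2 by rewrite sqrrN.
  by rewrite subrr.
Qed.

(** Integration of the derivative of [x^(n+1) (4 - x^2)^(3/2)], which is
[sqrt (4 - x^2) * (4 (n + 1) x^n - (n + 4) x^(n+2))]; the function vanishes at
both ends. *)
Lemma raw_moment_rec {R : realType} n :
  4 * n.+1%:R * raw_moment R n = (n.+4)%:R * raw_moment R n.+2.
Proof.
apply/eqP; rewrite -subr_eq0 /raw_moment.
have i0 k : (@lebesgue_measure R).-integrable `[(-2 : R), 2]
    (EFin \o (fun x : R => x ^+ k * semicircle x)).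
  apply: (@continuous_integrable R (fun x => x ^+ k * semicircle x)).
  exact: continuous_raw.
have i1 (c : R) k : (@lebesgue_measure R).-integrable `[(-2 : R), 2]
    (EFin \o (fun x : R => c * (x ^+ k * semicircle x))).
  apply: continuous_integrable => x.
  by apply: cvgM; [exact: cvg_cst|exact: continuous_raw].
rewrite -!RintegralZl// -RintegralB//; apply/eqP.
pose F (x : R) := x ^+ n.+1 * semicircle x ^+ 3.
apply: (etrans (@Rintegral_FTC R _ F _ _ _)).
- move=> x; apply: cvgB; (apply: cvgM; [exact: cvg_cst|exact: continuous_raw]).
- move=> x xI; have ds := is_derive_semicircle xI.
  have s0 := lt0r_neq0 (semicircle_gt0 xI).
  have s2 := sqr_semicircle xI.
  have dx : is_derive x 1 (fun x : R => x ^+ n.+1) (n.+1%:R * x ^+ n).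
    by split; [exact: exprn_derivable|rewrite exp_derive /GRing.scale/= mulr1].
  have d3 : is_derive x 1 (fun x : R => semicircle x ^+ 3) (- 3 * x * semicircle x).
    by apply: is_derive_eq; rewrite /GRing.scale/=; field.
  apply: (is_derive_eq (is_deriveM dx d3)); rewrite /GRing.scale/=.
  rewrite [semicircle x ^+ 3]exprS s2 -natr1 -[n.+4]addn4 natrD !exprS; ring.
- apply: continuous_subspaceT => x; apply: cvgM; first exact: exprn_continuous.
  exact: continuous_semicircle3.
- rewrite /F /semicircle; have -> : (-2 : R) ^+ 2 = 2 ^+ 2 by rewrite sqrrN.
  have -> : 4 - 2 ^+ 2 = 0 :> R by ring.
  by rewrite sqrtr0 expr0n/= !mulr0 subrr.
Qed.

(** Continuity up to the ends of the interval holds because [x |-> asin (x / 2)]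
is the inverse of the continuous injection [y |-> 2 * sin y] of
[[- pi / 2, pi / 2]]. *)
Lemma within_continuous_asin_half {R : realType} :
  {within `[(-2 : R), 2], continuous (fun x : R => asin (x / 2))}.
Proof.
pose f (y : R) := 2 * sin y.
have <- : f (- (pi / 2)) = -2 by rewrite /f sinN sin_pihalf; ring.
have E : f (pi / 2) = 2 by rewrite /f sin_pihalf mulr1.
rewrite -[X in `[_, X]]E.
apply: segment_can_le_continuous.
- by have := @pi_ge0 R; lra.
- apply: continuous_subspaceT => x; apply: cvgM; first exact: cvg_cst.
  exact: continuous_sin.
- move=> y yI; rewrite /f mulrAC divff// ?mul1r; exact: sinK.
Qed.

(** The area of the half disc of radius 2. *)
Lemma raw_moment0 {R : realType} : raw_moment R 0 = 2 * pi.
Proof.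
pose F (x : R) := 2^-1 * (x * semicircle x) + 2 * asin (x / 2).
apply: (etrans (@Rintegral_FTC R _ F _ _ _)).
- exact: continuous_raw.
- move=> x xI; have ds := is_derive_semicircle xI.
  have s0 := lt0r_neq0 (semicircle_gt0 xI).
  have s2 := sqr_semicircle xI.
  have da : is_derive x 1 (fun x : R => asin (x / 2)) (semicircle x)^-1.
    have x2 : -1 < x / 2 < 1.
      by move: xI; rewrite in_itv/= => /andP[? ?]; apply/andP; split; lra.
    have d1 : is_derive x 1 (fun x : R => x / 2) (2^-1).
      by apply: is_derive_eq; rewrite /GRing.scale/=; ring.
    have d2 := is_derive1_asin x2.
    have d3 := @is_derive1_comp _ (@asin R) (fun x : R => x / 2) _ _ _ d2 d1.
    apply: (is_derive_eq d3).
    have -> : 1 - (x / 2) ^+ 2 = (4 - x ^+ 2) / 2 ^+ 2 by field.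
    rewrite sqrtrM ?(ltW (semicircle_arg_gt0 xI))// -exprVn sqrtr_sqr.
    by rewrite ger0_norm ?invr_ge0// -/(semicircle x); field.
  rewrite /F; apply: is_derive_eq; rewrite /GRing.scale/=.
  have -> : x * (- x / semicircle x) = (semicircle x ^+ 2 - 4) / semicircle x.
    by rewrite s2; field.
  by rewrite expr0; field.
- apply: within_continuousD.
    apply: continuous_subspaceT => x; apply: cvgM; first exact: cvg_cst.
    by apply: cvgM; [exact: cvg_id|exact: continuous_semicircle].
  apply/subspace_continuousP => x xA; apply: cvgM; first exact: cvg_cst.
  have /subspace_continuousP asinC := @within_continuous_asin_half R.
  exact: (asinC x xA).
- rewrite /F /semicircle.
  have -> : (2 : R) / 2 = 1 by field.
  have -> : (- 2 : R) / 2 = - 1 by field.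
  have pi0 := @pi_ge0 R.
  have -> : asin (1 : R) = pi / 2.
    rewrite -[X in asin X](@sin_pihalf R) sinK// in_itv/=.
    by apply/andP; split; lra.
  have -> : asin (- 1 : R) = - (pi / 2).
    rewrite -[X in asin (- X)](@sin_pihalf R) -sinN sinK// in_itv/=.
    by apply/andP; split; lra.
  have -> : (-2 : R) ^+ 2 = 2 ^+ 2 by rewrite sqrrN.
  have -> : 4 - 2 ^+ 2 = 0 :> R by ring.
  by rewrite sqrtr0; field.
Unshelve. all: by []. Qed.

Lemma semicircle_moment_odd {R : realType} n :
  odd n -> semicircle_moment R n = 0.
Proof.
move=> on; rewrite semicircle_momentE -(odd_double_half n) on add1n.
elim: n./2 => [|k IHk]; first by rewrite double0 raw_moment1 mulr0.
have n4 : (k.*2.+1.+4)%:R != 0 :> R by rewrite pnatr_eq0.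
apply: (mulfI n4); rewrite doubleS mulrCA -raw_moment_rec mulr0 mulrCA IHk.
by rewrite mulr0.
Qed.

(** The factor [k.+1] on the left expresses without division that the moment is
the Catalan number ['C(2k, k) / (k + 1)]; both sides satisfy the recursion
[u_(k+1) / u_k = 2 (2k + 1) / (k + 1)]. *)
Lemma semicircle_moment_even {R : realType} k :
  k.+1%:R * semicircle_moment R k.*2 = 'C(k.*2, k)%:R.
Proof.
rewrite semicircle_momentE.
elim: k => [|k IHk].
  by rewrite raw_moment0 mulVf ?mulr1 ?bin0// mulf_neq0// lt0r_neq0// pi_gt0.
have n1 : (k.+1)%:R != 0 :> R by rewrite pnatr_eq0.
have r : k.+2%:R * ((2 * pi)^-1 * raw_moment R k.*2.+2) =
    2 * k.*2.+1%:R * ((2 * pi)^-1 * raw_moment R k.*2).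
  have := @raw_moment_rec R k.*2.
  have -> : k.*2.+4 = (2 * k.+2)%N by rewrite -doubleS -doubleS mul2n.
  rewrite natrM => r; set p := (2 * pi)^-1.
  transitivity (p / 2 * (2 * k.+2%:R * raw_moment R k.*2.+2)); first by field.
  by rewrite -r; field.
rewrite doubleS r; apply: (mulfI n1); rewrite mulrCA IHk.
rewrite -!natrM; congr (_%:R).
rewrite -(mul_bin_diag k.*2.+2)/= -mulnA (mul_bin_diag k.*2.+1)/= mulnA.
have <- : 'C(k.*2.+1, k.+1) = 'C(k.*2.+1, k).
  rewrite -(@bin_sub k.*2.+1 k); first by congr 'C(_, _); lia.
  by lia.
by congr (_ * _)%N; lia.
Qed.

End SemicircleMoments.

(** * Counting non-crossing pairings *)

Section NoncrossingInvolutions.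
Local Open Scope nat_scope.
Variable n : nat.
Implicit Types (f g : {ffun 'I_n -> 'I_n}) (i j k : 'I_n).

(** A non-crossing set of arcs on the points [0, ..., n-1] is encoded by the
involution that exchanges the two ends of each arc.  The second condition says
that a point strictly under the arc from [i] to [f i] is joined to another
point under it.  This forbids crossings, and also forbids fixed points under
an arc: the fixed points are those that may still be joined to a later point
without a crossing. *)
Definition nc_involution f : bool :=
  [forall i : 'I_n, f (f i) == i] &&
  [forall i : 'I_n, forall j : 'I_n,
     (i < j < f i) ==> (i < f j < f i) && (f j != j)].

Lemma nc_involutionP f :
  reflect (involutive f /\
    forall i j, i < j < f i -> (i < f j < f i) /\ f j != j)
  (nc_involution f).
Proof.
apply: (iffP andP) => -[fK nc]; split.
- by move=> i; apply/eqP; move/forallP: fK.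
- by move=> i j ij; move/forallP/(_ i)/forallP/(_ j)/implyP/(_ ij)/andP: nc.
- by apply/forallP => i; rewrite fK.
- apply/forallP => i; apply/forallP => j; apply/implyP => ij.
  by apply/andP/nc.
Qed.

Definition open_points m f : {set 'I_n} :=
  [set i : 'I_n | (i < m) && (f i == i)].

(** The pairings built on the first [m] points, of which [h] wait for a partner.
The points from [m] on are fixed, so that one ambient type ['I_n] serves for
all [m] and no reindexing is needed in the recursion on [m]. *)
Definition partial_pairings m h : {set {ffun 'I_n -> 'I_n}} :=
  [set f | [&& nc_involution f, [forall i : 'I_n, (m <= i) ==> (f i == i)]
             & #|open_points m f| == h]].

Lemma partial_pairingsP m h f :
  reflect [/\ involutive f,
    forall i j, i < j < f i -> (i < f j < f i) /\ f j != j,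
    forall i, m <= i -> f i = i & #|open_points m f| = h]
  (f \in partial_pairings m h).
Proof.
rewrite inE; apply: (iffP and3P).
  move=> [/nc_involutionP[fK nc] /forallP fm /eqP oh]; split=> // i mi.
  by apply/eqP; exact: (implyP (fm i)).
move=> [fK nc fm oh]; split; first exact/nc_involutionP.
  by apply/forallP => i; apply/implyP => mi; apply/eqP/fm.
exact/eqP.
Qed.

Lemma card_partial_pairings0 h : #|partial_pairings 0 h| = (h == 0).
Proof.
have o0 f : open_points 0 f = finset.set0.
  by apply/finset.setP => i; rewrite !inE ltn0.
case: eqP => [->|h0].
  rewrite -[RHS](cards1 ([ffun i => i] : {ffun 'I_n -> 'I_n})).
  apply: eq_card => f.
  apply/partial_pairingsP/finset.set1P.
    by move=> [_ _ f0 _]; apply/ffunP => i; rewrite ffunE f0.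
  move=> ->; split=> [i|i j|i _|]; rewrite ?ffunE ?o0 ?cards0//.
  by move=> /andP[ij ji]; have := ltn_trans ij ji; rewrite ltnn.
apply: eq_card0 => f; apply/negP => /partial_pairingsP[_ _ _].
by rewrite o0 cards0; exact/nesym.
Qed.

Lemma moved_lt m f i : involutive f -> (forall i, m <= i -> f i = i) ->
  f i != i -> f i < m.
Proof.
move=> fK fm; apply: contraNT; rewrite -leqNgt => /fm.
by rewrite fK => <-.
Qed.

Section Step.
Variable m : 'I_n.

Definition unlink f : {ffun 'I_n -> 'I_n} :=
  [ffun i => if (i == m) || (i == f m) then i else f i].

(** The default value [m] is taken only if no point is open. *)
Definition last_open f : 'I_n :=
  odflt m [pick j : 'I_n | (j \in open_points m f) &&
            [forall i : 'I_n, (i \in open_points m f) ==> (i <= j)]].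

(** Joining [m] to the last open point is the only way to close an arc at [m]:
an arc from an earlier open point would pass over the last one. *)
Definition link f : {ffun 'I_n -> 'I_n} :=
  [ffun i => if i == m then last_open f
             else if i == last_open f then m else f i].

Lemma last_openP f : open_points m f != finset.set0 ->
  [/\ last_open f < m, f (last_open f) = last_open f &
      forall i, i < m -> f i = i -> i <= last_open f].
Proof.
move=> /finset.set0Pn[j0 j0o]; rewrite /last_open; case: pickP => [j|none] /=.
  rewrite inE => /andP[/andP[jm /eqP fj] /forallP jmax]; split=> // i im fi.
  by apply: (implyP (jmax i)); rewrite inE im fi eqxx.
have [j jo jmax] := arg_maxnP (fun i : 'I_n => i : nat) j0o.
have /negP[] := negbT (none j); rewrite (jo : j \in open_points m f).
apply/forallP => i; by apply/implyP; exact: jmax.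
Qed.

Lemma last_open_uniq f j : j < m -> f j = j ->
  (forall i, j < i < m -> f i != i) -> last_open f = j.
Proof.
move=> jm fj jmax; have jo : j \in open_points m f by rewrite inE jm fj eqxx.
have [|lm fl lmax] := @last_openP f; first by apply/finset.set0Pn; exists j.
apply/val_inj/eqP; rewrite eqn_leq (lmax j jm fj) andbT leqNgt.
by apply/negP => jl; have := jmax (last_open f); rewrite jl lm fl eqxx => /(_ isT).
Qed.

Lemma link_in h f : f \in partial_pairings m h.+1 ->
  (link f \in partial_pairings m.+1 h) && (link f m != m).
Proof.
move=> /partial_pairingsP[fK nc fm oh].
have [|jm fj jmax] := @last_openP f; first by rewrite -card_gt0 oh.
rewrite /link; set j := last_open f in jm fj jmax *.
have fmm : f m = m by exact: fm.
have jNm : j != m by rewrite -val_eqE /= ltn_eqF.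
apply/andP; split; last by rewrite ffunE eqxx.
have lt_m i : f i != i -> f i < m by exact: moved_lt.
apply/partial_pairingsP; split.
- move=> i; rewrite !ffunE; case: (eqVneq i m) => [->|im].
    by rewrite (negbTE jNm) eqxx.
  case: (eqVneq i j) => [->|ij]; first by rewrite eqxx.
  by rewrite (inv_eq fK) fmm (negbTE im) (inv_eq fK) fj (negbTE ij) fK.
- move=> i k; rewrite !ffunE; case: (eqVneq i m) => [->|im].
    by move=> /andP[mk kj]; have := ltn_trans (ltn_trans mk kj) jm; rewrite ltnn.
  case: (eqVneq i j) => [->|ij] /andP[ik ki].
    (* the new arc, from [j] to [m]: no point between them is open, and an arc
       reaching over [j] would make [j] a fixed point under an arc *)
    have -> : (k == m) = false by apply/negbTE; rewrite -val_eqE /= neq_ltn ki.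
    have kj : (k == j) = false by apply/negbTE; rewrite -val_eqE /= neq_ltn ik orbT.
    have fk : f k != k.
      by apply/eqP => fk; have := jmax k ki fk; rewrite leqNgt ik.
    rewrite kj lt_m// andbT; split=> //.
    case: (ltngtP j (f k)) => // [fkj|/val_inj jfk]; last first.
      by move: kj; rewrite -[k]fK -jfk fj eqxx.
    have [|_] := nc (f k) j; first by rewrite fkj fK.
    by rewrite fj eqxx.
  have [|[nc1 nc2]] := nc i k; first by rewrite ik.
  have -> : (k == m) = false by apply: contraNF nc2 => /eqP ->; rewrite fmm.
  have -> : (k == j) = false by apply: contraNF nc2 => /eqP ->; rewrite fj.
  by [].
- move=> i mi; rewrite ffunE.
  rewrite -val_eqE -[i == j]val_eqE /= (gtn_eqF mi).
  rewrite (gtn_eqF (leq_trans jm (ltnW mi))).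
  exact/fm/ltnW.
- apply: succn_inj; rewrite -oh [RHS](cardsD1 j) inE jm fj eqxx /= add1n.
  congr _.+1; apply: eq_card => i; rewrite !inE ffunE ltnS.
  case: (eqVneq i m) => [->|im]; first by rewrite (negbTE jNm) ltnn !andbF.
  case: (eqVneq i j) => [->|ij]; first by rewrite eq_sym (negbTE jNm) andbF.
  by rewrite leq_eqVlt val_eqE (negbTE im).
Qed.

Lemma unlink_in h f : f \in partial_pairings m.+1 h -> f m != m ->
  unlink f \in partial_pairings m h.+1.
Proof.
move=> /partial_pairingsP[fK nc fm oh] fmm; rewrite /unlink.
set j := f m; have jm : j < m.
  have : j < m.+1 by exact: moved_lt fm fmm.
  by rewrite ltnS leq_eqVlt val_eqE (negbTE fmm).
have fj : f j = m by exact: fK.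
have jNm : (j == m) = false by exact: negbTE.
have lt_m i : f i != i -> f i < m.+1 by exact: moved_lt.
apply/partial_pairingsP; split.
- move=> i; rewrite !ffunE.
  case: (boolP ((i == m) || (i == j))) => [E|] /=; first by rewrite E.
  rewrite negb_or => /andP[im ij].
  by rewrite !(inv_eq fK) fj -/j orbC (negbTE im) (negbTE ij) fK.
- move=> i k; rewrite !ffunE; case: ifPn => [_ /andP[ik ki]|_ /andP[ik ki]].
    by have := ltn_trans ik ki; rewrite ltnn.
  have ifi : f i != i by rewrite -val_eqE /= neq_ltn (ltn_trans ik ki) orbT.
  have [|[nc1 nc2]] := nc i k; first by rewrite ik.
  (* no arc passes over [m], since the later points are fixed *)
  have mfi : (m < f i) = false by apply/negbTE; rewrite -leqNgt -ltnS lt_m.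
  have -> : (k == m) = false.
    by apply: contraFF mfi => /eqP <-.
  have -> : (k == j) = false.
    by apply: contraFF mfi => /eqP kj; move/andP: nc1 => []; rewrite kj fj.
  by [].
- move=> i mi; rewrite ffunE; case: ifPn => //; rewrite negb_or => /andP[im _].
  by apply: fm; rewrite ltn_neqAle mi andbT eq_sym val_eqE.
- rewrite (cardsD1 j) -oh !inE ffunE jm eqxx orbT eqxx add1n; congr _.+1.
  apply: eq_card => i; rewrite !inE ffunE ltnS.
  case: (eqVneq i m) => [->|im]; first by rewrite ltnn andbF -/j jNm andbF.
  case: (eqVneq i j) => [->|ij]; first by rewrite fj [m == j]eq_sym jNm andbF.
  by rewrite [in RHS]leq_eqVlt val_eqE (negbTE im).
Qed.

Lemma linkK h : {in partial_pairings m h.+1, cancel link unlink}.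
Proof.
move=> f /partial_pairingsP[fK nc fm oh].
have [|jm fj jmax] := @last_openP f; first by rewrite -card_gt0 oh.
apply/ffunP => i; rewrite !ffunE eqxx.
case: (eqVneq i m) => [->|im] /=; first by rewrite fm.
by case: (eqVneq i (last_open f)) => [->|ij].
Qed.

(** After the arc at [m] is removed, its left end is the last open point: there
was no fixed point under the arc. *)
Lemma unlinkK h f : f \in partial_pairings m.+1 h -> f m != m ->
  link (unlink f) = f.
Proof.
move=> /partial_pairingsP[fK nc fm oh] fmm.
have jm : f m < m.
  have : f m < m.+1 by exact: moved_lt fm fmm.
  by rewrite ltnS leq_eqVlt val_eqE (negbTE fmm).
have -> : link (unlink f) = [ffun i => if i == m then f m
             else if i == f m then m else unlink f i].
  apply/ffunP => i; rewrite !ffunE.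
  suff -> : last_open (unlink f) = f m by [].
  apply: last_open_uniq => //; first by rewrite ffunE eqxx orbT.
  move=> k /andP[jk km]; rewrite ffunE.
  rewrite -[k == m]val_eqE -[k == f m]val_eqE /= (ltn_eqF km) (gtn_eqF jk) /=.
  by have [|] := nc (f m) k; rewrite ?fK ?jk.
apply/ffunP => i; rewrite !ffunE.
case: (eqVneq i m) => [->//|im] /=.
by case: (eqVneq i (f m)) => [->|ij]; rewrite ?fK.
Qed.

Lemma card_moved_last h :
  #|[set f in partial_pairings m.+1 h | f m != m]| =
  #|partial_pairings m h.+1|.
Proof.
rewrite -(card_in_imset (can_in_inj (@linkK h))); apply: eq_card => f.
rewrite inE; apply/andP/imsetP.
  move=> [fP fm]; exists (unlink f); first exact: unlink_in.
  by rewrite (unlinkK fP).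
by move=> [g gP ->]; apply/andP/link_in.
Qed.

Lemma card_fixed_last h :
  #|[set f in partial_pairings m.+1 h | f m == m]| =
  (0 < h) * #|partial_pairings m h.-1|.
Proof.
have om f : f m = m -> #|open_points m.+1 f| = #|open_points m f|.+1.
  move=> fm; rewrite (cardsD1 m) inE ltnSn fm eqxx add1n; congr _.+1.
  apply: eq_card => i; rewrite !inE ltnS [in RHS]ltn_neqAle val_eqE.
  by rewrite andbA.
case: h => [|h].
  apply: eq_card0 => f; rewrite inE; apply/negP => /andP[].
  by move=> /partial_pairingsP[_ _ _ oh] /eqP /om; rewrite oh.
rewrite mul1n; apply: eq_card => f; rewrite inE; apply/andP/partial_pairingsP.
  move=> [/partial_pairingsP[fK nc fm oh] /eqP fmm]; split=> //.
    move=> i; rewrite leq_eqVlt => /predU1P[/val_inj <-//|]; exact: fm.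
  by apply: succn_inj; rewrite -om.
move=> [fK nc fm oh]; have fmm : f m = m by exact: fm.
split; last exact/eqP; apply/partial_pairingsP; split=> //.
  by move=> i /ltnW; exact: fm.
by rewrite om// oh.
Qed.

(** Either [m] stays open, or it closes the arc from the last open point.  What
remains on the points before [m] has one open point fewer in the first case,
and one more in the second. *)
Lemma card_partial_pairingsS h :
  #|partial_pairings m.+1 h| =
  (0 < h) * #|partial_pairings m h.-1| + #|partial_pairings m h.+1|.
Proof.
rewrite -card_fixed_last -card_moved_last.
rewrite -(cardsID [set f : {ffun 'I_n -> 'I_n} | f m == m]).
by congr (_ + _); apply: eq_card => f; rewrite !inE// andbC.
Qed.

End Step.

(** The ballot numbers: with [2q = m + h], the count
['C(m, q) - 'C(m, q + 1)] satisfies the recursion of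
[card_partial_pairingsS] by Pascal's rule, the case [h = 0] using the symmetry
['C(2q - 1, q) = 'C(2q - 1, q - 1)]. *)
Lemma card_partial_pairings m h q : m <= n -> m + h = q.*2 ->
  #|partial_pairings m h| + 'C(m, q.+1) = 'C(m, q).
Proof.
elim: m h q => [|m IHm] h q mn mhq.
  have -> : h = q.*2 by [].
  by rewrite card_partial_pairings0 !bin0n double_eq0 addn0.
rewrite (card_partial_pairingsS (Ordinal mn)) /=.
have := IHm h.+1 q (ltnW mn); rewrite addnS -addSn => /(_ mhq) IH1.
case: q mhq IH1 => [|q] // mhq IH1; rewrite !binS.
case: h mhq IH1 => [|h] mhq IH1 /=.
  have mq : m = q.*2.+1 by lia.
  have E : 'C(m, q.+1) = 'C(m, q).
    by rewrite -(@bin_sub m q); [congr 'C(_, _); lia|lia].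
  by rewrite mul0n add0n addnA IH1 E.
have IH2 : #|partial_pairings m h| + 'C(m, q.+1) = 'C(m, q).
  by apply: IHm (ltnW mn) _; lia.
by rewrite mul1n ['C(m, q.+2) + _]addnC addnACA IH1 IH2 addnC.
Qed.

Definition pair_partition f : {set {set 'I_n}} :=
  [set [set i; f i]%SET | i in 'I_n].

Lemma mem_pair_partition f i : [set i; f i]%SET \in pair_partition f.
Proof. by apply/imsetP; exists i. Qed.

Definition NC2 : {set {set {set 'I_n}}} :=
  [set g in NC n | [forall B in g, #|B| == 2]].

Lemma noncrossingP (g : {set {set 'I_n}}) :
  reflect (forall B B', B \in g -> B' \in g -> forall i j k l,
    i \in B -> k \in B -> j \in B' -> l \in B' ->
    i < j -> j < k -> k < l -> B = B')
  (noncrossing g).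
Proof.
apply: (iffP idP) => [ncg B B' Bg Bg' i j k l iB kB jB lB ij jk kl|ncg].
  move/forall_inP/(_ _ Bg)/forall_inP/(_ _ Bg')/forall_inP/(_ _ iB): ncg.
  move=> /forall_inP/(_ _ jB)/forall_inP/(_ _ kB)/forall_inP/(_ _ lB).
  by rewrite ij jk kl => /eqP.
apply/forall_inP => B Bg; apply/forall_inP => B' Bg'; apply/forall_inP => i iB.
apply/forall_inP => j jB; apply/forall_inP => k kB; apply/forall_inP => l lB.
apply/implyP => /and3P[ij jk kl]; apply/eqP.
exact: (ncg B B' Bg Bg' i j k l).
Qed.

Lemma fixed_point_free f : f \in partial_pairings n 0 -> forall i, f i != i.
Proof.
move=> /partial_pairingsP[_ _ _ /eqP]; rewrite cards_eq0 => /eqP o0 i.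
apply/negP => fi; suff : i \in open_points n f by rewrite o0 inE.
by rewrite inE ltn_ord.
Qed.

Lemma pair_blockE f i k : involutive f ->
  k \in [set i; f i]%SET -> [set i; f i]%SET = [set k; f k]%SET.
Proof.
move=> fK /finset.set2P[->//|->]; by rewrite fK finset.setUC.
Qed.

Lemma pair_partition_inj : {in partial_pairings n 0 &, injective pair_partition}.
Proof.
move=> f f' fP fP' eqff'; apply/ffunP => i.
have /partial_pairingsP[fK' _ _ _] := fP'.
have : [set i; f i]%SET \in pair_partition f' by rewrite -eqff' mem_pair_partition.
case/imsetP => k _ E.
have ik : i \in [set k; f' k]%SET by rewrite -E !inE eqxx.
have : f i \in [set i; f' i]%SET.
  by rewrite -(pair_blockE fK' ik) -E !inE eqxx orbT.
by case/finset.set2P => // /eqP; rewrite (negbTE (fixed_point_free fP i)).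
Qed.

(** For points [i < j < k < l] with [i], [k] in one block and [j], [l] in another,
[k = f i] and [l = f j], so [j] would lie under the arc of [i] without its partner [f j]. *)
Lemma pair_partition_NC2 f : f \in partial_pairings n 0 ->
  pair_partition f \in NC2.
Proof.
move=> fP; have fi := fixed_point_free fP.
have /partial_pairingsP[fK nc _ _] := fP.
rewrite inE; apply/andP; split; last first.
  by apply/forall_inP => B /imsetP[i _ ->]; rewrite cards2 [i == _]eq_sym fi.
rewrite inE; apply/andP; split.
  apply/and3P; split.
  - rewrite finset.eqEsubset finset.subsetT; apply/fintype.subsetP => i _.
    apply/bigcupP; exists [set i; f i]%SET; first exact: mem_pair_partition.
    by rewrite !inE eqxx.
  - apply/finset.trivIsetP => _ _ /imsetP[i _ ->] /imsetP[k _ ->].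
    apply: contraR; rewrite -finset.setI_eq0.
    move=> /finset.set0Pn[x /finset.setIP[xi xk]].
    by rewrite (pair_blockE fK xi) (pair_blockE fK xk).
  - apply/imsetP => -[i _ /finset.setP/(_ i)]; by rewrite !inE eqxx.
apply/noncrossingP => _ _ /imsetP[p _ ->] /imsetP[q _ ->].
move=> i j k l iB kB jB lB ij jk kl.
move: kB lB; rewrite (pair_blockE fK iB) (pair_blockE fK jB).
have ik := ltn_trans ij jk; have jl := ltn_trans jk kl.
case/finset.set2P => [ki|kfi]; first by move: ik; rewrite ki ltnn.
case/finset.set2P => [lj|lfj]; first by move: jl; rewrite lj ltnn.
have [|/andP[_]] := nc i j; first by rewrite ij -kfi.
by rewrite -kfi -lfj ltnNge (ltnW kl).
Qed.

(** The involution exchanges the two points of each block. *)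
Lemma NC2_pair_partition (g : {set {set 'I_n}}) : g \in NC2 ->
  exists2 f, f \in partial_pairings n 0 & g = pair_partition f.
Proof.
rewrite inE => /andP[]; rewrite inE => /andP[/and3P[/eqP cov triv g0]].
move=> /noncrossingP ncg /forall_inP card2.
have icov i : i \in finset.cover g by rewrite cov inE.
have pg i : finset.pblock g i \in g by rewrite finset.pblock_mem.
have ip i : i \in finset.pblock g i by rewrite finset.mem_pblock.
have partner i : exists j, (finset.pblock g i == [set i; j]%SET) && (j != i).
  have /cards2P[x [y [xy E]]] := card2 _ (pg i).
  have := ip i; rewrite E => /finset.set2P[->|->].
    by exists y; rewrite eqxx eq_sym.
  by exists x; rewrite finset.setUC eqxx.
pose f := [ffun i => xchoose (partner i)].
have fE i : finset.pblock g i = [set i; f i]%SET.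
  by have /andP[/eqP] := xchooseP (partner i); rewrite ffunE.
have fi i : f i != i by have /andP[_] := xchooseP (partner i); rewrite ffunE.
have pf i : finset.pblock g (f i) = finset.pblock g i.
  by apply: finset.same_pblock => //; rewrite fE !inE eqxx orbT.
have fK : involutive f.
  move=> i; have : f (f i) \in [set i; f i]%SET.
    by rewrite -fE -pf fE !inE eqxx orbT.
  by case/finset.set2P => // /eqP; rewrite (negbTE (fi _)).
have pne i j : j != i -> j != f i -> finset.pblock g i != finset.pblock g j.
  move=> ji jf; apply/eqP => E; have := ip j; rewrite -E fE !inE.
  by rewrite (negbTE ji) (negbTE jf).
exists f.
  apply/partial_pairingsP; split=> //.
  - move=> i j /andP[ij jf]; split=> //.
    have ji : j != i by rewrite -val_eqE /= gtn_eqF.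
    have jfi : j != f i by rewrite -val_eqE /= ltn_eqF.
    have := pne i j ji jfi => /eqP nE.
    have fji : f j != i by apply: contra jfi => /eqP <-; rewrite fK.
    have fjfi : f j != f i by rewrite (inj_eq (inv_inj fK)).
    have inb x : x \in finset.pblock g x /\ f x \in finset.pblock g x.
      by rewrite {2}fE !inE eqxx orbT ip.
    have [[ii fii] [jj fjj]] := (inb i, inb j).
    case: (ltngtP i (f j)) => [i_fj|fj_i|/val_inj E] /=; last first.
    + by rewrite E eqxx in fji.
    + case: nE; apply/esym; exact: (ncg _ _ (pg j) (pg i) (f j) i j (f i)).
    case: (ltngtP (f j) (f i)) => [//|fi_fj|/val_inj E] /=; last first.
    + by rewrite E eqxx in fjfi.
    + case: nE; exact: (ncg _ _ (pg i) (pg j) i j (f i) (f j)).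
  - by move=> i; rewrite leqNgt ltn_ord.
  - apply/eqP; rewrite cards_eq0; apply/eqP/finset.setP => i.
    by rewrite !inE (negbTE (fi i)) andbF.
apply/finset.setP => B; apply/idP/imsetP => [Bg|[i _ ->]]; last by rewrite -fE.
have /finset.set0Pn[x xB] : B != finset.set0 by apply: contraNneq g0 => <-.
by exists x => //; rewrite -fE; apply/esym/finset.def_pblock.
Qed.

Lemma card_NC2E : #|NC2| = #|partial_pairings n 0|.
Proof.
rewrite -(card_in_imset pair_partition_inj); apply: eq_card => g.
apply/idP/imsetP => [/NC2_pair_partition[f fP ->]|[f fP ->]].
  by exists f.
exact: pair_partition_NC2.
Qed.

End NoncrossingInvolutions.

Lemma card_NC2 k : #|NC2 k.*2| + 'C(k.*2, k.+1) = 'C(k.*2, k).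
Proof.
by rewrite card_NC2E; apply: card_partial_pairings => //; rewrite addn0.
Qed.

(** * Cumulants of identical and of free variables *)

Lemma NC_block_gt0 n (g : {set {set 'I_n}}) (B : {set 'I_n}) :
  g \in NC n -> B \in g -> (0 < #|B|)%N.
Proof.
rewrite inE => /andP[/and3P[_ _ g0] _] Bg.
by rewrite card_gt0; apply: contraNneq g0 => <-.
Qed.
Lemma card_NC_block n (g : {set {set 'I_n}}) (B : {set 'I_n}) :
  g \in NC n -> g != [set [set: 'I_n]%SET]%SET -> B \in g ->
  (0 < #|B| < n)%N.
Proof.
move=> gNC gT Bg; rewrite (NC_block_gt0 gNC Bg) /=.
move: gNC; rewrite inE => /andP[/and3P[/eqP cov triv g0] _].
rewrite ltnNge; apply: contra gT => nB.
have BT : B = [set: 'I_n]%SET.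
  by apply/eqP; rewrite finset.eqEcard finset.subsetT cardsT card_ord.
apply/eqP/finset.setP => C; rewrite inE; apply/idP/eqP => [Cg|->]; last first.
  by rewrite -BT.
rewrite -BT; apply/eqP; apply: contraNT g0 => CB.
have := finset.trivIsetP triv _ _ Cg Bg CB.
by rewrite BT -finset.setI_eq0 finset.setIT => /eqP <-.
Qed.

Lemma NC_blockP n (g : {set {set 'I_n}}) (i : 'I_n) :
  g \in NC n -> exists2 B, B \in g & i \in B.
Proof.
rewrite inE => /andP[/and3P[/eqP cov _ _] _].
have /bigcupP[B Bg iB] : i \in finset.cover g by rewrite cov inE.
by exists B.
Qed.

Lemma NC_one_block n : (0 < n)%N -> [set [set: 'I_n]]%SET \in NC n.
Proof.
move=> n0; rewrite inE; apply/andP; split.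
  apply/and3P; split.
  - by rewrite /finset.cover big_set1.
  - by apply/finset.trivIsetP => A B /finset.set1P-> /finset.set1P->; rewrite eqxx.
  - by rewrite inE eq_sym -card_gt0 cardsT card_ord.
by apply/noncrossingP => B B' /finset.set1P-> /finset.set1P->.
Qed.

Section Cumulants.
Local Open Scope ring_scope.
Context {R : realType} (S : ncps_typeB R) (kappa : seq (tbAX S) -> tbC R).
Hypothesis kappa_cum : is_typeB_cumulants kappa.
Implicit Types (p : tbAX S) (s : seq (tbAX S)).

Lemma moment_cumulant p n : (0 < n)%N ->
  \sum_(g in NC n) \prod_(B in g) kappa (nseq #|B| p) = tbE (p ^+ n).
Proof.
move=> n0; have [_ /(_ n (nseq_tuple n p) n0)] := kappa_cum.
have -> : \prod_(q <- nseq_tuple n p) q = p ^+ n.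
  by rewrite big_nseq -Monoid.iteropE.
move=> <-; apply: eq_bigr => g _; apply: eq_bigr => B _; congr kappa.
apply: (@eq_from_nth _ p); first by rewrite size_nseq size_map -cardE.
move=> i; rewrite size_nseq cardE => iB; rewrite nth_nseq -cardE.
rewrite cardE iB; case: (enum B) iB => // j0 e iB.
by rewrite (nth_map j0)// tnth_nseq.
Qed.

(** The partition with one block contributes the cumulant of order [n], and all
the other ones involve cumulants of lower order only: the cumulants are
determined by the moments, by recursion. *)
Lemma cumulantE p n : (0 < n)%N -> kappa (nseq n p) = tbE (p ^+ n) -
  \sum_(g in NC n | g != [set [set: 'I_n]]%SET) \prod_(B in g) kappa (nseq #|B| p).
Proof.
move=> n0; rewrite -moment_cumulant// (bigD1 [set [set: 'I_n]]%SET) /=; last first.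
  exact: NC_one_block.
by rewrite big_set1 cardsT card_ord addrK.
Qed.

Lemma cumulant_moments p q : identically_distributed p q ->
  forall n, (0 < n)%N -> kappa (nseq n p) = kappa (nseq n q).
Proof.
move=> pq; elim/ltn_ind => n IHn n0; rewrite !cumulantE// pq//; congr (_ - _).
apply: eq_bigr => g /andP[gNC gT]; apply: eq_bigr => B Bg.
by have /andP[B0 Bn] := card_NC_block gNC gT Bg; exact: IHn.
Qed.

Lemma cumulant1 p : kappa [:: p] = tbE p.
Proof.
rewrite (@cumulantE p 1)// expr1 big1 ?subr0// => g /andP[gNC gT].
have [B Bg _] := NC_blockP ord0 gNC.
by have := card_NC_block gNC gT Bg; lia.
Qed.

Lemma cumulant2 p : tbE p = 0 -> kappa (nseq 2 p) = tbE (p ^+ 2).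
Proof.
move=> p0; rewrite cumulantE// big1 ?subr0// => g /andP[gNC gT].
have [B Bg _] := NC_blockP ord0 gNC.
have B1 : #|B| = 1%N by have := card_NC_block gNC gT Bg; lia.
by rewrite (bigD1 B)//= B1 cumulant1 p0 mul0r.
Qed.

Lemma kappaD s1 s2 p q :
  kappa (s1 ++ p + q :: s2) = kappa (s1 ++ p :: s2) + kappa (s1 ++ q :: s2).
Proof. by have [lin _] := kappa_cum; have := lin s1 s2 1 p q; rewrite !scale1r. Qed.

Lemma kappa0 s1 s2 : kappa (s1 ++ 0 :: s2) = 0.
Proof. by apply: (addrI (kappa (s1 ++ 0 :: s2))); rewrite -kappaD !addr0. Qed.

Lemma kappaZ s1 s2 (z : R[i]) p :
  kappa (s1 ++ z *: p :: s2) = z *: kappa (s1 ++ p :: s2).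
Proof.
by have [lin _] := kappa_cum; have := lin s1 s2 z p 0; rewrite kappa0 !addr0.
Qed.

Lemma kappa_sum s1 s2 (I : Type) (r : seq I) (x : I -> tbAX S) :
  kappa (s1 ++ \sum_(k <- r) x k :: s2) = \sum_(k <- r) kappa (s1 ++ x k :: s2).
Proof.
exact: (big_morph (fun p => kappa (s1 ++ p :: s2)) (kappaD s1 s2) (kappa0 s1 s2)).
Qed.

Lemma kappa_nseqZ (z : R[i]) s n p :
  kappa (s ++ nseq n (z *: p)) = z ^+ n *: kappa (s ++ nseq n p).
Proof.
elim: n s => [|n IHn] s; first by rewrite scale1r.
by rewrite /= kappaZ -!cat_rcons IHn scalerA exprS.
Qed.

Variables (Ak : nat -> {pred tbA S}) (Xk : nat -> {pred tbX S}).
Hypothesis kappa_free : typeB_free kappa Ak Xk.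
Variable x : nat -> tbAX S.
Hypothesis xA : forall k, tbfst (x k) \in Ak k.
Hypothesis xX : forall k, tbsnd (x k) \in Xk k.

Lemma mixed_cumulant0 (cs : seq nat) c d : c \in cs -> d \in cs -> c != d ->
  kappa [seq x e | e <- cs] = 0.
Proof.
move=> ccs dcs cd.
apply: (@kappa_free _ (map_tuple x (in_tuple cs)) (tnth (in_tuple cs))).
  by move=> l; rewrite tnth_map; split.
have /tnthP[i ci] : c \in in_tuple cs by [].
have /tnthP[j dj] : d \in in_tuple cs by [].
case: (ltngtP i j) => [ij|ji|/val_inj ij].
- by exists i, j; split=> //; rewrite -ci -dj; exact/eqP.
- by exists j, i; split=> //; rewrite -ci -dj; apply/nesym/eqP.
- by move: cd; rewrite ci dj ij eqxx.
Qed.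

Variable N : nat.
Let sumx := \sum_(k < N) x k.

(** Expanding the sums one at a time, the two different indices already present
remain in every term. *)
Lemma mixed_cumulant_sum0 n (cs : seq nat) c d :
  c \in cs -> d \in cs -> c != d ->
  kappa ([seq x e | e <- cs] ++ nseq n sumx) = 0.
Proof.
elim: n cs => [|n IHn] cs ccs dcs cd.
  by rewrite cats0 (mixed_cumulant0 ccs dcs).
rewrite /= kappa_sum big1// => k _; rewrite -cat_rcons -map_rcons.
by apply: IHn => //; rewrite mem_rcons inE ?ccs ?dcs orbT.
Qed.

(** Once the index [k] has been chosen for one argument, the other sums can be
replaced with [x k], because every other choice gives a mixed cumulant. *)
Lemma cumulant_nseq_sum n j (k : 'I_N) :
  kappa (nseq j.+1 (x k) ++ nseq n sumx) = kappa (nseq (j.+1 + n) (x k)).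
Proof.
elim: n j => [|n IHn] j; first by rewrite cats0 addn0.
have cat_consE q (s s' : seq (tbAX S)) : s ++ q :: s' = (s ++ [:: q]) ++ s'.
  by rewrite -catA.
rewrite [nseq n.+1 _]/= kappa_sum (bigD1 k)// big1 => [|l /= lk] /=.
  rewrite addr0 -[_ :: _]/(nseq j.+1 (x k) ++ _) cat_consE.
  by rewrite -[[:: x k]]/(nseq 1 (x k)) -nseqD addn1 IHn addSnnS.
rewrite -[_ :: _]/(nseq j.+1 (x k) ++ _) cat_consE.
have -> : nseq j.+1 (x k) ++ [:: x l] =
    [seq x e | e <- nseq j.+1 (k : nat) ++ [:: l : nat]].
  by rewrite map_cat map_nseq.
apply: (@mixed_cumulant_sum0 _ _ k l).
- by rewrite mem_cat mem_nseq eqxx.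
- by rewrite mem_cat mem_head orbT.
- by rewrite eq_sym.
Qed.

Lemma cumulant_sum n :
  kappa (nseq n.+1 sumx) = \sum_(k < N) kappa (nseq n.+1 (x k)).
Proof.
rewrite -[nseq n.+1 sumx]/([::] ++ sumx :: nseq n sumx) kappa_sum.
by apply: eq_bigr => k _; rewrite -(cumulant_nseq_sum n 0 k).
Qed.

End Cumulants.

(** * The limit theorem *)

Section Limits.
Local Open Scope classical_set_scope.
Context {R : realType}.
Implicit Types (u v : nat -> tbC R) (K l : tbC R) (s : nat -> R[i]).

Lemma tbC_cvgD u v l K : tbC_cvg u l -> tbC_cvg v K ->
  tbC_cvg (fun N => u N + v N) (l + K).
Proof.
move=> [u1 u2] [v1 v2]; split.
- exact: (@cvgD _ R[i]^o _ _ _ _ _ _ _ u1 v1).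
- exact: (@cvgD _ R[i]^o _ _ _ _ _ _ _ u2 v2).
Qed.

Lemma tbC_cvg_cst l : tbC_cvg (fun=> l) l.
Proof. by split; exact: (@cvg_cst R[i]^o). Qed.

Lemma tbC_cvg_sum (I : Type) (r : seq I) (P : pred I)
    (F : I -> nat -> tbC R) (L : I -> tbC R) :
  (forall i, P i -> tbC_cvg (F i) (L i)) ->
  tbC_cvg (fun N => \sum_(i <- r | P i) F i N) (\sum_(i <- r | P i) L i).
Proof.
move=> FL; elim: r => [|i r IHr].
  by rewrite big_nil; under eq_fun do rewrite big_nil; exact: tbC_cvg_cst.
rewrite big_cons; under eq_fun do rewrite big_cons.
case: ifP => [Pi|_]; last exact: IHr.
exact: (tbC_cvgD (FL i Pi) IHr).
Qed.

Lemma tbC_cvgZ s (a : R[i]) K : s @ \oo --> (a : R[i]^o) ->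
  tbC_cvg (fun N => s N *: K) (a *: K).
Proof.
by move=> sa; split; exact: (@cvgM R[i] _ _ _ _ _ _ _ sa (@cvg_cst R[i]^o _ _ _ _)).
Qed.

Lemma tbC_cvg_near u v l : (forall N, (0 < N)%N -> u N = v N) ->
  tbC_cvg v l -> tbC_cvg u l.
Proof.
move=> uv [v1 v2]; split; [move: v1|move: v2]; apply: cvg_trans;
  by apply: near_eq_cvg; exists 1%N => //= N N0; rewrite uv.
Qed.

Definition inv_sqrt N : R[i] := (Num.sqrt (N%:R : R))^-1%:C.

Lemma sqr_inv_sqrt N : (0 < N)%N -> inv_sqrt N ^+ 2 * N%:R = 1.
Proof.
move=> N0; rewrite /inv_sqrt -rmorphXn/= exprVn sqr_sqrtr//.
by rewrite -(rmorph_nat (real_complex R)) -rmorphM/= mulVf ?pnatr_eq0 -?lt0n.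
Qed.

Lemma cvg_inv_sqrt : inv_sqrt @ \oo --> (0 : R[i]^o).
Proof.
apply/(@cvgr0Pnorm_lt R[i] R[i]^o) => e e0.
have [d d0 ->] : exists2 d : R, 0 < d & e = d%:C.
  by case: e e0 => d d' /=; rewrite ltcE /= => /andP[/eqP -> d0]; exists d.
have : \forall N \near \oo, d^-1 ^+ 2 < N%:R by exact: nbhs_infty_gtr.
apply: filterS => N dN; rewrite /inv_sqrt.
have N0 : 0 < N%:R :> R by apply: le_lt_trans dN; exact: sqr_ge0.
rewrite ger0_norm ?lecR ?invr_ge0 ?sqrtr_ge0// ltcR.
rewrite invf_plt ?posrE ?sqrtr_gt0//.
by rewrite -[ltLHS]ger0_norm ?invr_ge0 ?ltW// -sqrtr_sqr ltr_sqrt.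
Qed.

Lemma cvg_inv_sqrtX n : inv_sqrt N ^+ n.+1 @[N --> \oo] --> (0 : R[i]^o).
Proof.
elim: n => [|n IHn]; first exact: cvg_inv_sqrt.
under eq_fun do rewrite exprS; rewrite -[0](mulr0 0).
exact: (@cvgM R[i]) cvg_inv_sqrt IHn.
Qed.

Lemma tbC_exp11 k : (TbC 1 1 : tbC R) ^+ k = TbC 1 k%:R.
Proof.
elim: k => [//|k IHk]; rewrite exprS IHk; apply: tbC_eqP; rewrite /= ?mulr1//.
by rewrite !mul1r -natr1.
Qed.

End Limits.

Lemma sum_card_NC n (g : {set {set 'I_n}}) :
  g \in NC n -> (\sum_(B in g) #|B| = n)%N.
Proof.
by rewrite inE => /andP[/finset.card_partition <- _]; rewrite cardsT card_ord.
Qed.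

Lemma NC2_card n (g : {set {set 'I_n}}) : g \in NC2 n -> (n = #|g|.*2)%N.
Proof.
rewrite inE => /andP[/sum_card_NC gn /forall_inP g2].
rewrite -[LHS]gn (eq_bigr (fun=> 2%N)) => [|B /g2/eqP//].
by rewrite sum_nat_const muln2.
Qed.

(** Every block has at least two points, and some block at least three. *)
Lemma NC_not2_card n (g : {set {set 'I_n}}) : g \in NC n -> g \notin NC2 n ->
  (forall B, B \in g -> #|B| != 1%N) -> (#|g|.*2 < n)%N.
Proof.
move=> gNC; rewrite inE gNC /= => /forall_inPn[B Bg B2] g1.
have g2 C : C \in g -> (1 < #|C|)%N.
  by move=> Cg; rewrite ltn_neqAle eq_sym g1// (NC_block_gt0 gNC Cg).
rewrite -[ltnRHS](sum_card_NC gNC) -muln2 -sum_nat_const.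
rewrite (bigD1 B)//= [ltnRHS](bigD1 B)//=.
rewrite -addSn leq_add//; first by rewrite ltn_neqAle eq_sym B2 g2.
by apply: leq_sum => C /andP[Cg _]; exact: g2.
Qed.

Section CLT.
Context (R : realType) (S : ncps_typeB R) (kappa : seq (tbAX S) -> tbC R).
Hypothesis kappa_cum : is_typeB_cumulants kappa.
Variables (Ak : nat -> {pred tbA S}) (Xk : nat -> {pred tbX S}).
Hypothesis kappa_free : typeB_free kappa Ak Xk.
Variable x : nat -> tbAX S.
Hypothesis xA : forall k, tbfst (x k) \in Ak k.
Hypothesis xX : forall k, tbsnd (x k) \in Xk k.
Hypothesis x_id : forall j k, identically_distributed (x j) (x k).

Lemma cumulant_scaled_sum (c : R[i]) N n : (0 < n)%N ->
  kappa (nseq n (c *: \sum_(k < N) x k)) =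
  (c ^+ n * N%:R) *: kappa (nseq n (x 0)).
Proof.
case: n => // n _; rewrite -[nseq _ _]cat0s (kappa_nseqZ kappa_cum) cat0s.
rewrite (cumulant_sum kappa_cum kappa_free xA xX).
rewrite (eq_bigr (fun=> kappa (nseq n.+1 (x 0)))); last first.
  by move=> k _; apply: (cumulant_moments kappa_cum).
by rewrite sumr_const card_ord -scaler_nat scalerA.
Qed.

Lemma moment_scaled_sum (c : R[i]) N n : (0 < n)%N ->
  tbE ((c *: \sum_(k < N) x k) ^+ n) =
  \sum_(g in NC n) (c ^+ n * N%:R ^+ #|g|) *:
    \prod_(B in g) kappa (nseq #|B| (x 0)).
Proof.
move=> n0; rewrite -(moment_cumulant kappa_cum)//; apply: eq_bigr => g gNC.
rewrite (eq_bigr (fun B : {set 'I_n} =>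
  (c ^+ #|B| * N%:R) *: kappa (nseq #|B| (x 0)))).
  by rewrite scaler_prod big_split /= prodr_const -expr_sum sum_card_NC.
by move=> B Bg; apply: cumulant_scaled_sum; exact: NC_block_gt0 gNC Bg.
Qed.

Hypothesis x0 : tbE (x 0) = 0.
Hypothesis x02 : tbE (x 0 ^+ 2) = TbC 1 1.

(** The scalar is [N^(#|g| - n/2)]: it is 1 for a pairing and tends to 0 when
[#|g| < n/2]; in the remaining case [g] has a singleton, and the product of
cumulants is 0. *)
Lemma cvg_NC_term n (g : {set {set 'I_n}}) : g \in NC n ->
  tbC_cvg (fun N => (inv_sqrt N ^+ n * N%:R ^+ #|g|) *:
             \prod_(B in g) kappa (nseq #|B| (x 0)))
    (if g \in NC2 n then TbC 1 (n./2)%:R else 0).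
Proof.
move=> gNC; case: ifPn => [g2|gN2].
  have -> : \prod_(B in g) kappa (nseq #|B| (x 0)) = TbC 1 (n./2)%:R.
    rewrite (eq_bigr (fun=> TbC 1 1)); last first.
      move: g2; rewrite inE => /andP[_ /forall_inP g2] B /g2/eqP ->.
      by rewrite cumulant2.
    by rewrite prodr_const tbC_exp11 [in RHS](NC2_card g2) doubleK.
  apply: (@tbC_cvg_near _ _ (fun=> TbC 1 (n./2)%:R)); last exact: tbC_cvg_cst.
  move=> N N0; rewrite [X in _ ^+ X](NC2_card g2) -mul2n exprM -exprMn.
  by rewrite sqr_inv_sqrt// expr1n scale1r.
have [/exists_inP[B Bg /eqP B1]|noB] := boolP [exists B in g, #|B| == 1%N].
  rewrite (bigD1 B)//= B1 cumulant1// x0 mul0r.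
  by under eq_fun do rewrite scaler0; exact: tbC_cvg_cst.
have lt : (#|g|.*2 < n)%N.
  apply: NC_not2_card => // B Bg; apply: contra noB => B1.
  by apply/exists_inP; exists B.
rewrite -[X in tbC_cvg _ X](scale0r (\prod_(B in g) kappa (nseq #|B| (x 0)))).
apply: (@tbC_cvg_near _ _ (fun N => inv_sqrt N ^+ (n - #|g|.*2).-1.+1 *:
             \prod_(B in g) kappa (nseq #|B| (x 0)))).
  move=> N N0; rewrite prednK ?subn_gt0//; congr (_ *: _).
  rewrite -[X in _ ^+ X * _ = _](subnK (ltnW lt)) exprD -mulrA.
  rewrite -[X in _ * (_ ^+ X * _)]mul2n.
  by rewrite exprM -exprMn sqr_inv_sqrt// expr1n mulr1.
apply: tbC_cvgZ; exact: cvg_inv_sqrtX.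
Qed.

Lemma cvg_moments n : (0 < n)%N ->
  tbC_cvg (fun N => tbE ((inv_sqrt N *: \sum_(k < N) x k) ^+ n))
    (TbC #|NC2 n|%:R (#|NC2 n| * n./2)%:R).
Proof.
move=> n0.
have -> : TbC #|NC2 n|%:R (#|NC2 n| * n./2)%:R =
    \sum_(g in NC n) (if g \in NC2 n then TbC 1 (n./2)%:R else 0) :> tbC R.
  rewrite -big_mkcondr /=.
  rewrite (eq_bigl (fun g => g \in NC2 n)) => [|g]; last first.
    by rewrite /NC2 inE; case: (g \in NC n).
  rewrite sumr_const; elim: #|_| => [//|m IHm].
  rewrite mulrSr -IHm; apply: tbC_eqP; first by rewrite /= natr1.
  by rewrite mulSn addnC natrD.
under eq_fun do rewrite moment_scaled_sum//.
by apply: tbC_cvg_sum => g gNC; exact: cvg_NC_term.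
Qed.

End CLT.

(** For [n = 2k] this amounts to [(k + 1) c = 'C(2k, k)] and
[k c = 'C(2k, k + 1)], where [c = 'C(2k, k) - 'C(2k, k + 1)]; both follow from
[(k + 1) 'C(2k, k + 1) = k 'C(2k, k)]. *)
Lemma limit_moments (R : realType) n :
  TbC #|NC2 n|%:R (#|NC2 n| * n./2)%:R =
  TbC (semicircle_moment R n)%:C (infinitesimal_moment R n)%:C.
Proof.
rewrite /infinitesimal_moment; case: ifPn => [on|].
  rewrite semicircle_moment_odd//.
  have -> : #|NC2 n| = 0%N.
    apply: eq_card0 => g; apply: contraTF on => /NC2_card ->.
    by rewrite odd_double.
  by rewrite mul0n.
rewrite -dvdn2 => /dvdnP[k]; rewrite muln2 => ->; rewrite doubleK.
have k1 : k.+1%:R != 0 :> R by rewrite pnatr_eq0.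
have NC2k := card_NC2 k.
have Ck : (k.+1 * 'C(k.*2, k.+1) = k * 'C(k.*2, k))%N.
  by rewrite mul_bin_left -addnn addnK.
rewrite -!(rmorph_nat (real_complex R)); congr (TbC _%:C _%:C).
  apply: (mulfI k1); rewrite semicircle_moment_even -natrM; congr (_%:R).
  nia.
by congr (_%:R); nia.
Qed.

Theorem theorem5p1 (R : realType) (S : ncps_typeB R)
  (kappa : seq (tbAX S) -> tbC R)
  (hkappa : is_typeB_cumulants kappa)
  (Ak : nat -> {pred tbA S}) (Xk : nat -> {pred tbX S})
  (hA : forall k, GRing.subalg_closed (Ak k))
  (hX : forall k, GRing.submod_closed (Xk k))
  (hAX : forall k a xi b, a \in Ak k -> xi \in Xk k -> b \in Ak k ->
     tbact a xi b \in Xk k)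
  (hfree : typeB_free kappa Ak Xk)
  (a : nat -> tbA S) (xi : nat -> tbX S)
  (ha : forall k, a k \in Ak k) (hxi : forall k, xi k \in Xk k)
  (hid : forall j k,
     identically_distributed (TbAX (a j) (xi j)) (TbAX (a k) (xi k)))
  (hphi : forall k, tbphi S (a k) = 0) (hf : forall k, tbf S (xi k) = 0)
  (hvar : forall k, tbE (TbAX (a k) (xi k) ^+ 2) = TbC 1 1) :
  forall n : nat, (0 < n)%N ->
    tbC_cvg
      (fun N : nat =>
         tbE (((Num.sqrt (N%:R : R))^-1%:C *:
               \sum_(k < N) TbAX (a k) (xi k)) ^+ n))
      (TbC (semicircle_moment R n)%:C (infinitesimal_moment R n)%:C).
Proof.
move=> n n0; rewrite -limit_moments.
apply: (cvg_moments (x := fun k => TbAX (a k) (xi k)) hkappa hfree) => //.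
by rewrite /tbE /= hphi hf.
Qed.
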